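(* Let $n\ge2$, let $(\mathbf u_i)_{i=1}^{n+1}$ be a balanced $(n+1)$-frame in $\mathbb R^n$ with reciprocal edge vectors $\mathbf w_{ij}$, let $\rho_{ij}\ge0$ ($1\le i<j\le n+1$) be weights, and put $$A:=\sum_{i<j}\rho_{ij}\,\mathbf w_{ij}\mathbf w_{ij}^T .$$ If $A$ is positive definite, then $$\sum_{i<j}\rho_{ij}|\mathbf w_{ij}|\ \ge\ c_n\left(\frac{\det A}{\delta_{\mathbf u}^{\,n-1}}\right)^{1/n}.$$ Equality holds if and only if the frame is regular and all $\rho_{ij}$ are equal.
   Context: A balanced $(n+1)$-frame is a tuple $(\mathbf u_i)_{i=1}^{n+1}$ of vectors in $\mathbb R^n$ with $\sum_i\mathbf u_i=0$ and such that any $n$ of the vectors are linearly independent. All determinants of $n$ of the vectors have the same absolute value, denoted $\delta_{\mathbf u}:=|\det(\mathbf u_1,\dots,\mathbf u_n)|>0$. The frame is regular if for some $a>0$ one has $\mathbf u_i\cdot\mathbf u_j=a\bigl((n+1)\delta_{ij}-1\bigr)$ for all $i,j$, where $\delta_{ij}$ is the Kronecker delta. For $i\ne j$ the reciprocal edge vector $\mathbf w_{ij}\in\mathbb R^n$ is the unique vector with $\mathbf u_k\cdot\mathbf w_{ij}=\delta_{\mathbf u}(\delta_{ki}-\delta_{kj})$ for all $k\in\{1,\dots,n+1\}$. The constant is $c_n=\frac{n}{\sqrt2}(n+1)^{1/(2n)}$. $|\cdot|$ is the Euclidean norm. *)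

(* Defs.v *)
From mathcomp Require Import all_boot all_order all_algebra.
From mathcomp Require Import reals exp.

Set Implicit Arguments.
Unset Strict Implicit.
Unset Printing Implicit Defensive.

Import Order.TTheory GRing.Theory Num.Theory.

Local Open Scope ring_scope.

(* Indices 1..n+1 are encoded as 'I_n.+1, vectors of R^n as column vectors. *)

Definition dotp (R : realType) (n : nat) (x y : 'cV[R]_n) : R :=
  \sum_k x k 0 * y k 0.

(* The library norm `|x| on matrices is the sup norm. *)
Definition enorm (R : realType) (n : nat) (x : 'cV[R]_n) : R :=
  Num.sqrt (dotp x x).

Definition posdefmx (R : realType) (n : nat) (A : 'M[R]_n) : Prop :=
  A^T = A /\ forall x : 'cV[R]_n, x != 0 -> 0 < dotp x (A *m x).

(* Choosing n of the n+1 vectors is the same as omitting one of them;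
   lift i enumerates the indices different from i. *)
Definition balanced_frame (R : realType) (n : nat)
    (u : 'I_n.+1 -> 'cV[R]_n) : Prop :=
  \sum_i u i = 0 /\ forall i : 'I_n.+1, free [tuple u (lift i j) | j < n].

(* lift ord_max j has the same value as j, so the j-th column is u_j and the
   omitted vector is the last one. *)
Definition frame_det (R : realType) (n : nat) (u : 'I_n.+1 -> 'cV[R]_n) : R :=
  `|\det (\matrix_(k < n, j < n) u (lift ord_max j) k 0)|.

Definition regular_frame (R : realType) (n : nat)
    (u : 'I_n.+1 -> 'cV[R]_n) : Prop :=
  exists2 a : R, 0 < a &
    forall i j, dotp (u i) (u j) = a * (n.+1%:R * (i == j)%:R - 1).

Definition edge_vector (R : realType) (n : nat) (u : 'I_n.+1 -> 'cV[R]_n)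
    (i j : 'I_n.+1) (x : 'cV[R]_n) : Prop :=
  forall k, dotp (u k) x = frame_det u * ((k == i)%:R - (k == j)%:R).

(* On the diagonal w is unconstrained. *)
Definition reciprocal_edges (R : realType) (n : nat)
    (u : 'I_n.+1 -> 'cV[R]_n) (w : 'I_n.+1 -> 'I_n.+1 -> 'cV[R]_n) : Prop :=
  forall i j, i != j -> edge_vector u i j (w i j).

Definition weighted_mx (R : realType) (n : nat)
    (rho : 'I_n.+1 -> 'I_n.+1 -> R) (w : 'I_n.+1 -> 'I_n.+1 -> 'cV[R]_n) :
    'M[R]_n :=
  \sum_(i < n.+1) \sum_(j < n.+1 | (i < j)%N) rho i j *: (w i j *m (w i j)^T).

Definition weighted_length (R : realType) (n : nat)
    (rho : 'I_n.+1 -> 'I_n.+1 -> R) (w : 'I_n.+1 -> 'I_n.+1 -> 'cV[R]_n) : R :=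
  \sum_(i < n.+1) \sum_(j < n.+1 | (i < j)%N) rho i j * enorm (w i j).

Definition frame_cst (R : realType) (n : nat) : R :=
  n%:R / Num.sqrt 2 * n.+1%:R `^ (2 * n)%:R^-1.

Lemma edge_vector_unique (R : realType) (n : nat) (u : 'I_n.+1 -> 'cV[R]_n)
    (i j : 'I_n.+1) :
  balanced_frame u -> exists! x, edge_vector u i j x.
Proof.
case=> su fu; set d := frame_det u.
pose M := \matrix_(k < n, l < n) u (lift ord_max k) l 0.
have uM : M \in unitmx.
  rewrite -row_free_unit; have /freeP F := fu ord_max.
  apply: inj_row_free => v vM0; apply/rowP=> k; rewrite mxE.
  apply: (F (fun k => v 0 k)); apply/colP=> l; rewrite summxE [RHS]mxE.
  have := congr1 (fun z : 'rV_n => z 0 l) vM0; rewrite !mxE => vMl.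
  rewrite -[RHS]vMl; apply: eq_bigr => p _.
  by rewrite !mxE -tnth_nth tnth_mktuple.
have dM k x : dotp (u (lift ord_max k)) x = (M *m x) k 0.
  by rewrite mxE; apply: eq_bigr => l _; rewrite mxE.
pose b (k : 'I_n.+1) : R := d * ((k == i)%:R - (k == j)%:R).
exists (invmx M *m \col_k b (lift ord_max k)); split=> [|y hy]; last first.
  rewrite -[y](mulKmx uM); congr (_ *m _).
  by apply/colP=> k; rewrite -dM hy mxE.
set x := _ *m _.
have hl k : dotp (u (lift ord_max k)) x = b (lift ord_max k).
  by rewrite dM mulKVmx // mxE.
have sd : \sum_k dotp (u k) x = 0.
  rewrite exchange_big big1 // => l _; rewrite -mulr_suml -summxE su mxE.
  by rewrite mul0r.
have sb : \sum_k b k = 0.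
  rewrite -mulr_sumr sumrB.
  have e (p : 'I_n.+1) : \sum_k ((k == p)%:R : R) = 1.
    by rewrite (bigD1 p) //= eqxx big1 ?addr0 // => q /negPf ->.
  by rewrite !e subrr mulr0.
move=> k; case: (unliftP ord_max k) => [l|] ->; first exact: hl.
have split0 (F : 'I_n.+1 -> R) :
    \sum_k F k = F ord_max + \sum_l F (lift ord_max l).
  exact: bigD1_ord.
move: sd; rewrite split0 (eq_bigr _ (fun l _ => hl l)) => sd.
move: sb; rewrite split0 => sb.
exact: (addIr (\sum_l b (lift ord_max l)) (etrans sd (esym sb))).
Qed.

(* Main.v *)
Require Import Defs.
From mathcomp Require Import all_boot all_order all_algebra.
From mathcomp Require Import reals exp ring zify.

(** Let [e_ij] be the differences of standard basis vectors of [R^(n+1)] and let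
    [E] be an [n x (n+1)] matrix whose rows are an orthonormal basis of the
    hyperplane of vectors of coordinate sum [0].  The vectors [f_ij = E e_ij],
    all of norm [sqrt 2], are the edges of a regular simplex, and every
    reciprocal edge is [w_ij = T f_ij] for one invertible matrix [T], with
    [|det T| = delta^(n-1) / sqrt (n+1)].  Hence [A = T L T^T] for
    [L = sum rho_ij f_ij f_ij^T], and with [X = L T^T]

      [|det X| = sqrt (n+1) * det A / delta^(n-1)],

    so that the inequality to prove, multiplied by [sqrt 2], is
    [sum rho_ij |f_ij| |T f_ij| >= n |det X|^(1/n)].

    This holds for any weighted family of vectors ([sum_enorm_ge_det]).  Choose
    [Q] orthogonal such that [X Q] is triangular with a nonnegative diagonal
    (the QR decomposition).  By Cauchy-Schwarz, each [|f_ij| |T f_ij|] is at least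
    [(T f_ij) . (Q f_ij)], and these inner products, weighted by [rho_ij], add up
    to the trace of [X Q].  The trace is the sum of a nonnegative diagonal whose
    product is [|det X|], and the inequality of arithmetic and geometric means
    concludes.

    In the case of equality, [T f_ij] is a nonnegative multiple [s_ij] of
    [Q f_ij] whenever [rho_ij <> 0].  Then [X Q = sum rho_ij s_ij f_ij f_ij^T] is
    symmetric and triangular with a constant diagonal, hence scalar: a weighted
    graph Laplacian with weights [rho_ij s_ij] is proportional to the one of the
    complete graph, so these weights are all equal ([edge_form_scalar_weights]).
    They do not vanish, so all edges [f_ij] are eigenvectors of [Q^T T]; sharing
    vertices, they have the same eigenvalue ([edge_eigen_const]).  So [T] is a
    multiple of [Q], which means that the frame is regular ([regular_frameP]), and
    the [rho_ij] are equal ([rigidity]).  The converse is a computation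
    ([similarity_equality]). *)

Set Implicit Arguments.
Unset Strict Implicit.
Unset Printing Implicit Defensive.

Import Order.TTheory GRing.Theory Num.Theory.

Local Open Scope ring_scope.

(** * Euclidean norms of column vectors *)

Section WeightedFamily.
Context {R : realType}.
Implicit Types (n : nat).

Lemma dotpE n (x y : 'cV[R]_n) : dotp x y = (x^T *m y) 0 0.
Proof. by rewrite mxE; apply: eq_bigr => k _; rewrite mxE. Qed.

Lemma dotpC n (x y : 'cV[R]_n) : dotp x y = dotp y x.
Proof. by apply: eq_bigr => k _; rewrite mulrC. Qed.

Lemma dotp_mulmx n m (A : 'M[R]_(n, m)) (x : 'cV[R]_m) (y : 'cV[R]_n) :
  dotp (A *m x) y = dotp x (A^T *m y).
Proof. by rewrite !dotpE trmx_mul mulmxA. Qed.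

Lemma dotpZl n a (x y : 'cV[R]_n) : dotp (a *: x) y = a * dotp x y.
Proof. by rewrite !dotpE linearZ -scalemxAl mxE. Qed.

Lemma dotpBl n (x y z : 'cV[R]_n) : dotp (x - y) z = dotp x z - dotp y z.
Proof. by rewrite !dotpE linearB mulmxBl !mxE. Qed.

Lemma dotpp_ge0 n (x : 'cV[R]_n) : 0 <= dotp x x.
Proof. by apply: sumr_ge0 => k _; rewrite -expr2 sqr_ge0. Qed.

Lemma dotpp_eq0 n (x : 'cV[R]_n) : dotp x x = 0 -> x = 0.
Proof.
move=> /eqP; rewrite psumr_eq0; last by move=> k _; rewrite -expr2 sqr_ge0.
move=> /allP h; apply/colP=> k; rewrite mxE.
by have := h k (mem_index_enum k); rewrite mulf_eq0 orbb => /eqP.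
Qed.

Lemma enorm_ge0 n (x : 'cV[R]_n) : 0 <= enorm x.
Proof. exact: sqrtr_ge0. Qed.

Lemma sqr_enorm n (x : 'cV[R]_n) : enorm x ^+ 2 = dotp x x.
Proof. by rewrite sqr_sqrtr ?dotpp_ge0. Qed.

Lemma enorm_eq0 n (x : 'cV[R]_n) : enorm x = 0 -> x = 0.
Proof. by move=> h; apply: dotpp_eq0; rewrite -sqr_enorm h expr0n. Qed.

Lemma enorm_gt0 n (x : 'cV[R]_n) : x != 0 -> 0 < enorm x.
Proof.
move=> x0; rewrite lt_neqAle enorm_ge0 andbT eq_sym.
by apply: contra_neq x0 => /enorm_eq0.
Qed.

Lemma enormN n (x : 'cV[R]_n) : enorm (- x) = enorm x.
Proof. by rewrite /enorm -!sqr_enorm -scaleN1r /enorm !dotpZl dotpC dotpZl !mulN1r opprK. Qed.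

Lemma enorm_orthomx n (Q : 'M[R]_n) (x : 'cV[R]_n) :
  Q^T *m Q = 1%:M -> enorm (Q *m x) = enorm x.
Proof. by move=> oQ; rewrite /enorm dotp_mulmx mulmxA oQ mul1mx. Qed.

(** The defect in the Cauchy-Schwarz inequality is the square of a vector, which
    yields the inequality together with its case of equality. *)
Lemma dotp_enorm_diff n (x y : 'cV[R]_n) (z := enorm y *: x - enorm x *: y) :
  dotp z z = 2 * (enorm x * enorm y) * (enorm x * enorm y - dotp x y).
Proof.
rewrite /z dotpBl !dotpZl ![dotp _ (_ - _)]dotpC !dotpBl !dotpZl.
rewrite -!sqr_enorm [dotp y x]dotpC; ring.
Qed.

Lemma dotp_le_enorm n (x y : 'cV[R]_n) : dotp x y <= enorm x * enorm y.
Proof.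
have := dotp_enorm_diff x y; set z := _ - _ => zz.
have [->|/enorm_gt0 x0] := eqVneq x 0.
  by rewrite -(scale0r 0) dotpZl mul0r mulr_ge0 ?enorm_ge0.
have [->|/enorm_gt0 y0] := eqVneq y 0.
  by rewrite dotpC -(scale0r 0) dotpZl mul0r mulr_ge0 ?enorm_ge0.
by rewrite -subr_ge0 -(@pmulr_rge0 _ (2 * (enorm x * enorm y))) ?mulr_gt0 // -zz dotpp_ge0.
Qed.

Lemma dotp_eq_enorm n (x y : 'cV[R]_n) :
  dotp x y = enorm x * enorm y -> enorm y *: x = enorm x *: y.
Proof.
move=> h; apply/eqP; rewrite -subr_eq0; apply/eqP/dotpp_eq0.
by rewrite dotp_enorm_diff h subrr mulr0.
Qed.

(** * Orthogonal triangularization *)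

(** [Q] is the reflection along [x - y], which exchanges two vectors of the same
    length. *)
Lemma householder n (x y : 'rV[R]_n) :
  x *m x^T = y *m y^T -> exists2 Q : 'M[R]_n, Q^T *m Q = 1%:M & x *m Q = y.
Proof.
move=> xy; have [->|/eqP neq] := x =P y; first by exists 1%:M; rewrite ?trmx1 ?mulmx1.
have [v vE] : exists v, v = x - y by exists (x - y).
pose s := (v *m v^T) 0 0.
have vv : v *m v^T = s%:M by rewrite [LHS]mx11_scalar.
have s0 : s != 0.
  apply: contra_neq neq => s0; apply/eqP; rewrite -subr_eq0 -vE -[v]trmxK.
  by rewrite [v^T]dotpp_eq0 ?trmx0 // dotpE trmxK.
(* By equality of lengths, the projection of [x] on [v = x - y] is [v / 2], so that
   the reflection subtracts [v] from [x]. *)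
have xv : x *m v^T = (s / 2)%:M.
  have yx : y *m x^T = x *m y^T.
    by rewrite [LHS]mx11_scalar -tr_scalar_mx -mx11_scalar trmx_mul trmxK.
  have : v *m v^T = 2 *: (x *m v^T).
    rewrite vE linearB /= mulmxBl !mulmxBr -xy yx scalerBr !scaler_nat !mulr2n opprB opprD.
    by rewrite addrACA.
  move=> /(congr1 (fun z => 2^-1 *: z)); rewrite scalerA mulVf ?pnatr_eq0 // scale1r => <-.
  by rewrite vv scale_scalar_mx mulrC.
have sQ : (1%:M - (2 / s) *: (v^T *m v))^T = 1%:M - (2 / s) *: (v^T *m v).
  by rewrite linearB linearZ /= trmx1 trmx_mul trmxK.
exists (1%:M - (2 / s) *: (v^T *m v)).
  rewrite sQ mulmxBl mul1mx mulmxBr mulmx1 -scalemxAl -scalemxAr.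
  rewrite mulmxA -[v^T *m v *m v^T]mulmxA vv mul_mx_scalar -scalemxAl !scalerA.
  have -> : 2 / s * (2 / s * s) = 2 / s + 2 / s by field.
  by rewrite scalerDl opprB addrK subrK.
rewrite mulmxBr mulmx1 -scalemxAr mulmxA xv mul_scalar_mx scalerA.
have -> : 2 / s * (s / 2) = 1 by field.
by rewrite scale1r vE opprB addrC subrK.
Qed.

(** A QR decomposition, transposed: a reflection sends the first row of [X] to a
    nonnegative multiple of the first basis vector, and the remaining block is
    treated by induction.  The signs on the diagonal make the trace of [X *m Q]
    comparable to [|det X|]. *)
Lemma orthogonal_triangularization n (X : 'M[R]_n) :
  exists Q : 'M[R]_n,
    [/\ Q^T *m Q = 1%:M, is_trig_mx (X *m Q) & forall i, 0 <= (X *m Q) i i].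
Proof.
elim: n X => [|n IH] X.
  exists 1%:M; split; first by rewrite trmx1 mulmx1.
    by apply/is_trig_mxP => -[].
  by case.
pose x : 'rV_(1 + n) := usubmx (X : 'M_(1 + n)).
pose y : 'rV_(1 + n) := row_mx (enorm x^T)%:M 0.
have [|Q oQ xQ] := @householder _ x y.
  rewrite tr_row_mx mul_row_col trmx0 mulmx0 addr0 tr_scalar_mx -scalar_mxM.
  by rewrite [LHS]mx11_scalar -expr2 sqr_enorm dotpE trmxK.
pose Y := dsubmx (X : 'M_(1 + n)) *m Q.
have XQ : (X : 'M_(1 + n)) *m Q = block_mx (enorm x^T)%:M 0 (lsubmx Y) (rsubmx Y).
  by rewrite -[X in X *m Q](vsubmxK (X : 'M_(1 + n))) mul_col_mx -/x xQ -/Y block_mxEv hsubmxK.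
have [Q' [oQ' tQ' dQ']] := IH (rsubmx Y).
pose H : 'M_(1 + n) := block_mx 1%:M 0 0 Q'.
have XQH : (X : 'M_(1 + n)) *m (Q *m H) = block_mx (enorm x^T)%:M 0 (lsubmx Y) (rsubmx Y *m Q').
  by rewrite mulmxA XQ [LHS](@mulmx_block _ 1 n 1 n 1 n) !mulmx1 !mulmx0 !mul0mx !addr0 !add0r.
exists (Q *m H); split.
- rewrite trmx_mul mulmxA -[H^T *m _ *m Q]mulmxA oQ mulmx1 /H tr_block_mx.
  rewrite (@mulmx_block _ 1 n 1 n 1 n) !trmx0 !mulmx0 !mul0mx trmx1 mulmx1 !addr0 !add0r oQ'.
  by rewrite -scalar_mx_block.
- by rewrite XQH [is_trig_mx _](@is_trig_block_mx _ 1 n 1 n) // eqxx tQ' mx11_is_trig.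
- move=> i; rewrite XQH; case: (split_ordP (i : 'I_(1 + n))) => j ->.
    by rewrite [leRHS](@block_mxEul _ 1 n 1 n) mxE ord1 eqxx enorm_ge0.
  by rewrite [leRHS](@block_mxEdr _ 1 n 1 n).
Qed.

(** * The inequality for a weighted family of vectors *)

Lemma rootnK n (x : R) : (0 < n)%N -> 0 <= x -> (x ^+ n) `^ n%:R^-1 = x.
Proof.
by move=> n0 x0; rewrite -powR_mulrn // -powRrM mulfV ?powRr1 // pnatr_eq0 -lt0n.
Qed.

(** The determinant is the product of the diagonal and the trace its sum, so this
    is the inequality of arithmetic and geometric means. *)
Lemma AMGM_trig n (L : 'M[R]_n) : (0 < n)%N -> is_trig_mx L ->
    (forall i, 0 <= L i i) ->
  n%:R * `|\det L| `^ n%:R^-1 <= \tr L /\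
  (\tr L = n%:R * `|\det L| `^ n%:R^-1 -> forall i, L i i = \tr L / n%:R).
Proof.
move=> n0 tL dL.
have n0R : (0 : R) < n%:R by rewrite ltr0n.
have detE : `|\det L| = \prod_i L i i by rewrite det_trig // ger0_norm ?prodr_ge0.
pose mu := \tr L / n%:R.
have mu0 : 0 <= mu by rewrite divr_ge0 ?ler0n // sumr_ge0.
have trE : \tr L = n%:R * mu by rewrite mulrC divfK // gt_eqF.
have := @leif_AGM R 'I_n predT (fun i => L i i) (fun i _ => dL i).
rewrite card_ord -/mu -detE => -[le1 eq1].
have p0 : 0 <= `|\det L| := normr_ge0 _.
split.
  rewrite trE ler_pM2l // -[leRHS](rootnK n0 mu0).
  by apply: ge0_ler_powR; rewrite ?nnegrE ?invr_ge0 ?ler0n ?exprn_ge0.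
rewrite {1}trE => /(mulfI (lt0r_neq0 n0R)) muE i.
have eqmu : `|\det L| == mu ^+ n.
  by rewrite muE -powR_mulrn ?powR_ge0 // -powRrM mulVf ?lt0r_neq0 // powRr1.
have /forall_inP eqL := etrans (esym eq1) eqmu.
rewrite /mu; have -> : \tr L = n%:R * L i i.
  rewrite /mxtrace (eq_bigr (fun _ => L i i)); last first.
    by move=> j _; have /forall_inP/(_ i isT)/eqP := eqL j isT.
  by rewrite sumr_const card_ord mulr_natl.
by rewrite mulrC mulKf // gt_eqF.
Qed.

(** With [X *m Q] triangular as above, [len] dominates [\tr (X *m Q)] by
    Cauchy-Schwarz, applied to [T *m x i] and [Q *m x i].  In the case of equality
    these vectors are parallel whenever [rho i != 0], which turns [X *m Q] into a
    combination of the symmetric matrices [x i *m (x i)^T]; being also triangular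
    with a constant diagonal, it is scalar. *)
Lemma sum_enorm_ge_det n (I : finType) (P : pred I) (rho : I -> R)
    (x : I -> 'cV[R]_n) (T : 'M[R]_n)
    (X := (\sum_(i | P i) rho i *: (x i *m (x i)^T)) *m T^T)
    (len := \sum_(i | P i) rho i * (enorm (x i) * enorm (T *m x i))) :
    (0 < n)%N -> (forall i, P i -> 0 <= rho i) ->
  n%:R * `|\det X| `^ n%:R^-1 <= len /\
  (len = n%:R * `|\det X| `^ n%:R^-1 ->
   exists (Q : 'M[R]_n) (r : R), [/\ Q^T *m Q = 1%:M, X *m Q = r%:M &
     forall i, P i -> x i != 0 -> rho i != 0 ->
       T *m x i = (enorm (T *m x i) / enorm (x i)) *: (Q *m x i)]).
Proof.
move=> n0 rho0; have [Q [oQ tQ dQ]] := orthogonal_triangularization X.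
have [AG AGeq] := AMGM_trig n0 tQ dQ.
have detXQ : `|\det (X *m Q)| = `|\det X|.
  have : (\det Q) ^+ 2 = 1 by rewrite expr2 -{1}det_tr -det_mulmx oQ det1.
  by rewrite det_mulmx normrM => /eqP; rewrite sqr_norm_eq1 => /eqP ->; rewrite mulr1.
have XQE : X *m Q = \sum_(i | P i) rho i *: (x i *m (T *m x i)^T *m Q).
  rewrite /X !mulmx_suml; apply: eq_bigr => i _.
  by rewrite -!scalemxAl trmx_mul !mulmxA.
have trE : \tr (X *m Q) = \sum_(i | P i) rho i * dotp (T *m x i) (Q *m x i).
  rewrite XQE raddf_sum; apply: eq_bigr => i _ /=.
  by rewrite mxtraceZ -mulmxA mxtrace_mulC trace_mx11 dotpE mulmxA.
have cs i : dotp (T *m x i) (Q *m x i) <= enorm (x i) * enorm (T *m x i).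
  by rewrite (le_trans (dotp_le_enorm _ _)) // (enorm_orthomx _ oQ) mulrC.
have trle : \tr (X *m Q) <= len.
  by rewrite trE; apply: ler_sum => i Pi; rewrite ler_wpM2l // rho0.
rewrite detXQ in AG AGeq.
split=> [|lenE]; first exact: le_trans AG trle.
have trlen : \tr (X *m Q) = len by apply/eqP; rewrite eq_le trle lenE AG.
have par i : P i -> x i != 0 -> rho i != 0 ->
    T *m x i = (enorm (T *m x i) / enorm (x i)) *: (Q *m x i).
  move=> Pi xi0 rhoi0.
  have /eqP : \sum_(i | P i) rho i * 
      (enorm (x i) * enorm (T *m x i) - dotp (T *m x i) (Q *m x i)) = 0.
    rewrite (eq_bigr _ (fun i _ => mulrBr _ _ _)) sumrB -trE trlen subrr //.
  rewrite psumr_eq0 => [/allP/(_ i (mem_index_enum i))|j Pj]; last first.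
    by rewrite mulr_ge0 ?rho0 // subr_ge0.
  rewrite Pi /= mulf_eq0 (negPf rhoi0) /= subr_eq0 => /eqP/esym.
  rewrite -(enorm_orthomx (x i) oQ) mulrC => /dotp_eq_enorm; rewrite (enorm_orthomx _ oQ) => e.
  by rewrite mulrC -scalerA -e scalerA mulVf ?scale1r // gt_eqF // enorm_gt0.
exists Q, (\tr (X *m Q) / n%:R); split=> //.
have sym : (X *m Q)^T = X *m Q.
  rewrite XQE raddf_sum; apply: eq_bigr => i Pi /=.
  have [->|xi0] := eqVneq (x i) 0; first by rewrite !mul0mx !scaler0 trmx0.
  have [->|rhoi0] := eqVneq (rho i) 0; first by rewrite !scale0r trmx0.
  have -> : x i *m (T *m x i)^T *m Q
            = (enorm (T *m x i) / enorm (x i)) *: (x i *m (x i)^T).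
    rewrite (par _ Pi xi0 rhoi0) [(_ *: _)^T]linearZ /= trmx_mul.
    by rewrite -par // -scalemxAr -scalemxAl -!mulmxA oQ mulmx1.
  by rewrite scalerA !linearZ /= trmx_mul trmxK.
apply/matrixP=> i j; rewrite [RHS]mxE; have [->|] := eqVneq i j.
  by rewrite AGeq // trlen.
rewrite neq_ltn => /orP[|] ij; first by rewrite (is_trig_mxP tQ) ?mulr0n.
by rewrite -sym mxE (is_trig_mxP tQ) ?mulr0n.
Qed.

End WeightedFamily.

(** * Determinants, and the regular simplex *)

(** Both sides are the determinant of [block_mx 1 (- C) B 1], factored in the
    two orders (the Weinstein-Aronszajn identity). *)
Lemma det_1D_mulmxC (R : comNzRingType) m n (B : 'M[R]_(m, n)) (C : 'M[R]_(n, m)) :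
  \det (1%:M + B *m C) = \det (1%:M + C *m B).
Proof.
pose D := block_mx 1%:M (- C) B 1%:M.
have D1 : D = block_mx 1%:M 0 B 1%:M *m block_mx 1%:M (- C) 0 (1%:M + B *m C).
  rewrite mulmx_block !mulmx1 !mul1mx !mul0mx !addr0 mulmxN.
  by rewrite addrCA addNr addr0.
have D2 : D = block_mx (1%:M + C *m B) (- C) 0 1%:M *m block_mx 1%:M 0 B 1%:M.
  by rewrite mulmx_block !mulmx1 !mul1mx !mul0mx !mulmx0 !add0r mulNmx addrK.
have := congr1 determinant D1; rewrite D2 !det_mulmx !det_ublock !det_lblock !det1.
by rewrite !mulr1 !mul1r.
Qed.

Section RealMatrices.
Context {R : realType}.

(** Induction on the size by the Schur complement [S] of the top left entry, which
    inherits positive definiteness.  The sign of [\det A] matters since the real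
    power of a negative number is a junk value. *)
Lemma posdefmx_det_gt0 n (A : 'M[R]_n) : posdefmx A -> 0 < \det A.
Proof.
elim: n A => [|n IH] A; first by rewrite det_mx00.
move: A; rewrite -[n.+1]/(1 + n)%N => A [sA pA].
pose a := ulsubmx A 0 0; pose b := ursubmx A; pose C := drsubmx A.
have AE : A = block_mx a%:M b b^T C.
  rewrite -[LHS]submxK -mx11_scalar; congr (block_mx _ _ _ _).
  by rewrite trmx_ursub sA.
have a0 : 0 < a.
  have := pA (col_mx 1 0); rewrite AE mul_block_col !mulmx1 !mulmx0 !addr0.
  rewrite dotpE tr_col_mx mul_row_col trmx0 mul0mx addr0 trmx1 mul1mx mxE eqxx.
  apply; rewrite col_mx_eq0 negb_and oner_eq0 //.
pose S := C - a^-1 *: (b^T *m b).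
have detA : \det A = a * \det S.
  have : block_mx 1%:M 0 (- (a^-1 *: b^T)) 1%:M *m A = block_mx a%:M b 0 S.
    rewrite AE mulmx_block !mul1mx !mul0mx !addr0 !mulNmx -!scalemxAl.
    by rewrite mul_mx_scalar scalerA mulVf ?gt_eqF // scale1r addNr addrC.
  move=> /(congr1 determinant); rewrite det_mulmx det_lblock !det1 !mul1r => ->.
  by rewrite det_ublock det_scalar1.
rewrite detA mulr_gt0 //; apply: IH; split.
  rewrite /S linearB linearZ /= trmx_mul trmxK; congr (_ - _).
  by rewrite /C trmx_drsub sA.
(* Given [y], this is the vector with lower part [y] that minimizes the form of [A];
   its image under [A] is [col_mx 0 (S *m y)]. *)
move=> y y0; have := pA (col_mx (- (a^-1 *: (b *m y))) y).
rewrite col_mx_eq0 negb_and y0 orbT => /(_ isT).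
rewrite AE mul_block_col mul_scalar_mx scalerN scalerA mulfV ?gt_eqF // scale1r addNr.
rewrite mulmxN -scalemxAr addrC mulmxA scalemxAl -mulmxBl -/S.
by rewrite dotpE tr_col_mx mul_row_col mulmx0 add0r -dotpE.
Qed.

(** The columns of [E] are the vertices of a regular simplex centered at the
    origin.  To build it, take an orthogonal matrix whose first column is
    proportional to the all-ones vector: the other columns are the rows of [E]. *)
Lemma regular_simplex n :
  exists E : 'M[R]_(n, n.+1),
    E *m E^T = 1%:M /\ E^T *m E = 1%:M - n.+1%:R^-1 *: const_mx 1.
Proof.
pose c : R := Num.sqrt n.+1%:R.
have cc : c * c = n.+1%:R by rewrite -expr2 sqr_sqrtr ?ler0n.
have c0 : c != 0 by apply/eqP => c0; move/eqP: cc; rewrite c0 mul0r eq_sym pnatr_eq0.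
pose x : 'rV[R]_(1 + n) := const_mx 1; pose y : 'rV[R]_(1 + n) := row_mx c%:M 0.
have [|Q oQ xQ] := @householder _ _ x y.
  rewrite tr_row_mx mul_row_col mul0mx addr0 tr_scalar_mx -scalar_mxM cc.
  rewrite [LHS]mx11_scalar mxE (eq_bigr (fun=> 1)) ?sumr_const ?card_ord // => i _.
  by rewrite !mxE mulr1.
have oQ' := mulmx1C oQ.
pose h := usubmx Q^T; pose E := dsubmx Q^T.
have QE : Q^T = col_mx h E by rewrite vsubmxK.
have QE' : Q = row_mx h^T E^T by rewrite -tr_col_mx -QE trmxK.
have hE : c *: h = x.
  by rewrite -[x]mulmx1 -oQ' mulmxA xQ QE mul_row_col mul0mx addr0 mul_scalar_mx.
exists E; split.
  have := oQ; rewrite QE QE' mul_col_row scalar_mx_block => /eq_block_mx[_ _ _ ->] //.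
have := oQ'; rewrite QE' tr_row_mx !trmxK mul_row_col => <-.
have -> : h = c^-1 *: x by rewrite -hE scalerA mulVf // scale1r.
rewrite [(_ *: x)^T]linearZ /= -scalemxAl -scalemxAr scalerA -invfM cc.
have -> : x^T *m x = const_mx 1; last by rewrite addrAC subrr add0r.
by apply/matrixP=> i j; rewrite mxE big_ord1 !mxE mulr1.
Qed.

End RealMatrices.

(** * Differences of basis vectors and weighted Laplacians *)

Section BasisDifferences.
Context {R : realType} {n : nat}.

Definition unit_diff (i j : 'I_n.+1) : 'cV[R]_n.+1 := delta_mx i 0 - delta_mx j 0.

Lemma unit_diffE i j a : unit_diff i j a 0 = (a == i)%:R - (a == j)%:R.
Proof. by rewrite !mxE !andbT. Qed.

Lemma unit_diffC i j : unit_diff j i = - unit_diff i j.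
Proof. by rewrite /unit_diff opprB. Qed.

Lemma const_mulmx_unit_diff m i j : const_mx 1 *m unit_diff i j = 0 :> 'M_(m, 1).
Proof.
apply/matrixP=> a b; rewrite mxE [RHS]mxE ord1.
rewrite (eq_bigr (fun k => (k == i)%:R - (k == j)%:R)); last first.
  by move=> k _; rewrite unit_diffE mxE mul1r.
have e (p : 'I_n.+1) : \sum_k ((k == p)%:R : R) = 1.
  by rewrite (bigD1 p) //= eqxx big1 ?addr0 // => q /negPf ->.
by rewrite sumrB !e subrr.
Qed.

Lemma dotp_delta (i : 'I_n.+1) (y : 'cV[R]_n.+1) : dotp (delta_mx i 0) y = y i 0.
Proof. by rewrite dotpE trmx_delta -rowE mxE. Qed.

Lemma dotp_unit_diff i j : i != j -> dotp (unit_diff i j) (unit_diff i j) = 2.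
Proof.
move=> /negPf ij; rewrite {1}/unit_diff dotpBl !dotp_delta !unit_diffE.
by rewrite !eqxx [j == i]eq_sym ij subr0 sub0r opprK.
Qed.

(** The matrix is the Laplacian of the complete graph with edge weights [s], from
    which the weights can be read off. *)
Lemma laplacian_offdiag (s : 'I_n.+1 -> 'I_n.+1 -> R) (a b : 'I_n.+1) :
  (a < b)%N ->
  (\sum_(p : 'I_n.+1 * 'I_n.+1 | (p.1 < p.2)%N)
     s p.1 p.2 *: (unit_diff p.1 p.2 *m (unit_diff p.1 p.2)^T)) a b = - s a b.
Proof.
move=> ab; have nab : a != b by rewrite neq_ltn ab.
have ent i j : (s i j *: (unit_diff i j *m (unit_diff i j)^T)) a b =
    s i j * (((a == i)%:R - (a == j)%:R) * ((b == i)%:R - (b == j)%:R)).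
  by rewrite mxE [in LHS]mxE big_ord1 [_^T _ _]mxE !unit_diffE.
rewrite summxE (bigD1 (a, b)) //= ent /= !eqxx (negPf nab) [b == a]eq_sym (negPf nab).
rewrite big1 => [|[i j] /= /andP[ij]]; first by rewrite addr0 subr0 sub0r mulrN1 mulrN mulr1.
rewrite xpair_eqE ent /= -!val_eqE /= => nij.
(* A nonzero entry needs [a] and [b] to be the two ends of the edge [(i, j)], and the
   orientations [a < b] and [i < j] exclude the swapped case. *)
by do 4! case: eqP => ?; rewrite ?subrr ?subr0 ?mul0r ?mulr0 //; exfalso; lia.
Qed.

(** The row sums determine the diagonal from the entries off the diagonal. *)
Lemma sym_mx_eq (M N : 'M[R]_n.+1) : M^T = M -> N^T = N ->
  M *m const_mx 1 = N *m const_mx 1 :> 'cV_n.+1 ->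
  (forall i j : 'I_n.+1, (i < j)%N -> M i j = N i j) -> M = N.
Proof.
move=> sM sN r1 up.
have off i j : i != j -> M i j = N i j.
  rewrite neq_ltn => /orP[] ij; first exact: up.
  by rewrite -sM -sN !mxE up.
apply/matrixP=> i j; have [<-|] := eqVneq i j; last exact: off.
move/(congr1 (fun z : 'cV_n.+1 => z i 0)): r1; rewrite !mxE.
rewrite (bigD1 i) //= [RHS](bigD1 i) //= !mxE !mulr1 (eq_bigr (fun k => N i k * 1)).
  rewrite [in RHS](eq_bigr (fun k => N i k * 1)) => [|k _]; last by rewrite mxE.
  exact: addIr.
by move=> k ki; rewrite mxE off // eq_sym.
Qed.

Lemma complete_laplacian :
  \sum_(p : 'I_n.+1 * 'I_n.+1 | (p.1 < p.2)%N)
     (unit_diff p.1 p.2 *m (unit_diff p.1 p.2)^T) = n.+1%:R%:M - const_mx 1.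
Proof.
apply: sym_mx_eq.
- rewrite raddf_sum; apply: eq_bigr => p _ /=; by rewrite trmx_mul trmxK.
- by rewrite linearB /= tr_scalar_mx trmx_const.
- rewrite mulmx_suml big1 => [|p _]; last first.
    by rewrite -mulmxA -[const_mx 1]trmxK -trmx_mul trmx_const const_mulmx_unit_diff trmx0 mulmx0.
  rewrite mulmxBl mul_scalar_mx; apply/esym/eqP; rewrite subr_eq0; apply/eqP/colP=> i.
  by rewrite !mxE mulr1 (eq_bigr (fun=> 1)) ?sumr_const ?card_ord // => k _; rewrite !mxE mulr1.
- move=> i j ij; have := laplacian_offdiag (fun _ _ => 1) ij.
  rewrite (eq_bigr (fun p => unit_diff p.1 p.2 *m (unit_diff p.1 p.2)^T)) => [->|p _].
    by rewrite !mxE -val_eqE /= ltn_eqF // sub0r.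
  by rewrite scale1r.
Qed.

End BasisDifferences.

(** * Reciprocal edges as images of the edges of the regular simplex *)

Section Frames.
Context {R : realType} {n : nat}.
Implicit Types (u : 'I_n.+1 -> 'cV[R]_n) (E : 'M[R]_(n, n.+1)).

Definition frame_mx u : 'M[R]_(n.+1, n) := \matrix_(k, l) u k l 0.

Lemma frame_mxE u k x : dotp (u k) x = (frame_mx u *m x) k 0.
Proof. by rewrite mxE; apply: eq_bigr => l _; rewrite mxE. Qed.

Lemma frame_mx_gram u i j : dotp (u i) (u j) = (frame_mx u *m (frame_mx u)^T) i j.
Proof. by rewrite frame_mxE !mxE; apply: eq_bigr => l _; rewrite !mxE. Qed.

Lemma frame_det_gt0 u : balanced_frame u -> 0 < frame_det u.
Proof.
case=> _ /(_ ord_max) /freeP F; rewrite normr_gt0 -unitfE -unitmxE -unitmx_tr -row_free_unit.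
apply: inj_row_free => v vM0; apply/rowP=> k; rewrite mxE.
apply: (F (fun k => v 0 k)); apply/colP=> l; rewrite summxE [RHS]mxE.
have := congr1 (fun z : 'rV_n => z 0 l) vM0; rewrite !mxE => vMl.
rewrite -[RHS]vMl; apply: eq_bigr => p _.
by rewrite !mxE -tnth_nth tnth_mktuple.
Qed.

Lemma const_mul_frame_mx u m : \sum_i u i = 0 -> const_mx 1 *m frame_mx u = 0 :> 'M_(m, n).
Proof.
move=> su; apply/matrixP=> i j; rewrite mxE [RHS]mxE.
move/(congr1 (fun z : 'cV_n => z j 0)): su; rewrite summxE mxE => su; rewrite -[RHS]su.
by apply: eq_bigr => k _; rewrite !mxE mul1r.
Qed.

(** As [u ord_max] is minus the sum of the other vectors, the product is
    [V (1 + o o^T) V^T], with [V] the matrix defining [frame_det] and [o] the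
    all-ones vector. *)
Lemma det_frame_gram u : \sum_i u i = 0 ->
  \det ((frame_mx u)^T *m frame_mx u) = n.+1%:R * frame_det u ^+ 2.
Proof.
move=> su; pose V := \matrix_(k < n, j < n) u (lift ord_max j) k 0.
pose o : 'cV[R]_n := const_mx 1.
have um k : u ord_max k 0 = - (V *m o) k 0.
  move/(congr1 (fun z : 'cV_n => z k 0)): su; rewrite summxE mxE (bigD1_ord ord_max) //=.
  move/eqP; rewrite addr_eq0 => /eqP ->; congr (- _); rewrite mxE.
  by apply: eq_bigr => l _; rewrite !mxE mulr1.
have -> : (frame_mx u)^T *m frame_mx u = V *m (1%:M + o *m o^T) *m V^T.
  rewrite mulmxDr mulmx1 mulmxDl addrC mulmxA -[V *m o *m o^T *m V^T]mulmxA -trmx_mul.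
  apply/matrixP=> k l; rewrite mxE (bigD1_ord ord_max) //= 2!mxE um [frame_mx _ _ _]mxE um mulrNN.
  rewrite [RHS]mxE [in RHS]mxE big_ord1 [(_ *m _)^T _ _]mxE; congr (_ + _); rewrite mxE.
  by apply: eq_bigr => i _; rewrite !mxE.
rewrite !det_mulmx det_tr det_1D_mulmxC (_ : 1%:M + o^T *m o = n.+1%:R%:M).
  by rewrite det_scalar1 mulrAC [RHS]mulrC -normrX ger0_norm ?sqr_ge0 // expr2.
rewrite [LHS]mx11_scalar !mxE eqxx (eq_bigr (fun=> 1)); last by move=> k _; rewrite !mxE mulr1.
by rewrite sumr_const card_ord -[1%:R]/(1%:R) -natrD.
Qed.

Section Simplex.
Context (E : 'M[R]_(n, n.+1)) (EEt : E *m E^T = 1%:M)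
  (EtE : E^T *m E = 1%:M - n.+1%:R^-1 *: const_mx 1).

Let n1 : n.+1%:R != 0 :> R. Proof. by rewrite pnatr_eq0. Qed.

Lemma simplex_const m : E *m const_mx 1 = 0 :> 'M_(n, m).
Proof.
have EJ : E *m const_mx 1 = 0 :> 'M_(n, n.+1).
  have := congr1 (mulmx E) EtE; rewrite mulmxA EEt mul1mx mulmxBr mulmx1 -scalemxAr.
  move=> h; have : n.+1%:R^-1 *: (E *m const_mx 1) = 0 :> 'M_(n, n.+1).
    by rewrite -[LHS](subKr E) -h subrr.
  by move=> /eqP; rewrite scaler_eq0 invr_eq0 (negPf n1) => /eqP.
apply/matrixP=> i j; have := congr1 (fun z : 'M_(n, n.+1) => z i ord0) EJ.
by rewrite !mxE => h; rewrite -[RHS]h; apply: eq_bigr => k _; rewrite !mxE.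
Qed.

Lemma simplex_unit_diff i j : E^T *m (E *m unit_diff i j) = unit_diff i j.
Proof.
by rewrite mulmxA EtE mulmxBl mul1mx -scalemxAl const_mulmx_unit_diff scaler0 subr0.
Qed.

Lemma enorm_simplex_edge i j : i != j -> enorm (E *m unit_diff i j) = Num.sqrt 2.
Proof. by move=> ij; rewrite /enorm dotp_mulmx simplex_unit_diff dotp_unit_diff. Qed.

Lemma simplex_frame u : \sum_i u i = 0 -> E^T *m (E *m frame_mx u) = frame_mx u.
Proof.
by move=> su; rewrite mulmxA EtE mulmxBl mul1mx -scalemxAl const_mul_frame_mx // scaler0 subr0.
Qed.

(** The projection [E^T *m E] fixes the columns of [frame_mx u], so [frame_mx u] and
    [E *m frame_mx u] have the same Gram determinant. *)
Lemma det_simplex_frame u : \sum_i u i = 0 ->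
  `|\det (E *m frame_mx u)| = Num.sqrt n.+1%:R * frame_det u.
Proof.
move=> su; apply: (@pexpIrn _ 2) => //; rewrite ?nnegrE ?mulr_ge0 ?sqrtr_ge0 ?normr_ge0 //.
rewrite exprMn sqr_sqrtr ?ler0n // -det_frame_gram //.
have -> : (frame_mx u)^T *m frame_mx u = (E *m frame_mx u)^T *m (E *m frame_mx u).
  by rewrite trmx_mul -mulmxA simplex_frame.
by rewrite det_mulmx det_tr -normrX ger0_norm ?sqr_ge0 // expr2.
Qed.

(** The linear map sending the edges of the regular simplex to the reciprocal
    edge vectors. *)
Definition edge_map u := frame_det u *: invmx (E *m frame_mx u).

Lemma simplex_frame_unit u : balanced_frame u -> E *m frame_mx u \in unitmx.
Proof.
move=> bu; rewrite unitmxE unitfE -normr_gt0 det_simplex_frame; last by case: bu.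
by rewrite mulr_gt0 ?sqrtr_gt0 ?ltr0n ?frame_det_gt0.
Qed.

Lemma frame_edge_map u : balanced_frame u -> (E *m frame_mx u) *m edge_map u = (frame_det u)%:M.
Proof. by move=> bu; rewrite -scalemxAr mulmxV ?simplex_frame_unit // scalemx1. Qed.

Lemma edge_vector_simplex u i j : balanced_frame u ->
  edge_vector u i j (edge_map u *m (E *m unit_diff i j)).
Proof.
move=> bu k; rewrite frame_mxE -(simplex_frame (proj1 bu)) -mulmxA [_ *m (edge_map u *m _)]mulmxA.
by rewrite frame_edge_map // mul_scalar_mx -scalemxAr simplex_unit_diff mxE unit_diffE.
Qed.

(** Reciprocal edge vectors are determined by their inner products with the
    frame. *)
Lemma reciprocal_edgesE u w : balanced_frame u -> reciprocal_edges u w ->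
  forall i j, i != j -> w i j = edge_map u *m (E *m unit_diff i j).
Proof.
move=> bu rw i j ij; have [x [_ ux]] := edge_vector_unique i j bu.
by rewrite -(ux _ (rw i j ij)) -(ux _ (edge_vector_simplex i j bu)).
Qed.

Lemma det_edge_map u : balanced_frame u -> (0 < n)%N ->
  `|\det (edge_map u)| * Num.sqrt n.+1%:R = frame_det u ^+ (n - 1).
Proof.
move=> bu n0; have d0 := frame_det_gt0 bu; apply: (mulIf (lt0r_neq0 d0)).
rewrite -exprSr subn1 prednK // -mulrA -det_simplex_frame; last by case: bu.
by rewrite -normrM mulrC -det_mulmx frame_edge_map // det_scalar ger0_norm // exprn_ge0 ?ltW.
Qed.

End Simplex.
End Frames.

(** * The case of equality *)

Section Rigidity.
Context {R : realType} {n : nat} (E : 'M[R]_(n, n.+1)).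
Context (EEt : E *m E^T = 1%:M)
  (EtE : E^T *m E = 1%:M - n.+1%:R^-1 *: const_mx 1).

Let n1 : n.+1%:R != 0 :> R. Proof. by rewrite pnatr_eq0. Qed.

Definition simplex_edge (i j : 'I_n.+1) : 'cV[R]_n := E *m unit_diff i j.

Definition edge_form (rho : 'I_n.+1 -> 'I_n.+1 -> R) : 'M[R]_n :=
  \sum_(p : 'I_n.+1 * 'I_n.+1 | (p.1 < p.2)%N)
    rho p.1 p.2 *: (simplex_edge p.1 p.2 *m (simplex_edge p.1 p.2)^T).

(** Conjugation by [E] turns [edge_form s] into a weighted Laplacian and [r%:M]
    into the multiple [r] of the projection onto the vectors of sum [0], whose
    entries off the diagonal are all [- r / n.+1]. *)
Lemma edge_form_scalar_weights s r : edge_form s = r%:M ->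
  forall i j : 'I_n.+1, (i < j)%N -> s i j = r / n.+1%:R.
Proof.
move=> fr i j ij; apply: oppr_inj; rewrite -(laplacian_offdiag s ij).
have -> : \sum_(p : 'I_n.+1 * 'I_n.+1 | (p.1 < p.2)%N)
     s p.1 p.2 *: (unit_diff p.1 p.2 *m (unit_diff p.1 p.2)^T) = E^T *m edge_form s *m E.
  rewrite /edge_form mulmx_sumr mulmx_suml; apply: eq_bigr => p _.
  rewrite -scalemxAr -scalemxAl -[in LHS](simplex_unit_diff EtE p.1 p.2).
  by rewrite -/(simplex_edge _ _) trmx_mul trmxK !mulmxA.
rewrite fr mul_mx_scalar -scalemxAl EtE !mxE -val_eqE /= ltn_eqF // sub0r mulr1.
by rewrite mulrN.
Qed.

Lemma edge_form_const : edge_form (fun _ _ => 1) = n.+1%:R%:M.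
Proof.
rewrite /edge_form (eq_bigr (fun p => E *m (unit_diff p.1 p.2 *m (unit_diff p.1 p.2)^T) *m E^T)).
  rewrite -mulmx_suml -mulmx_sumr complete_laplacian mulmxBr (simplex_const EEt EtE) subr0.
  by rewrite mul_mx_scalar -scalemxAl EEt scalemx1.
by move=> p _; rewrite scale1r /simplex_edge trmx_mul !mulmxA.
Qed.

(** The edges of the simplex span the space: [N *m E] has equal columns, since [N]
    kills the edges, and the columns of [E] add up to [0]. *)
Lemma mx_eq_on_edges (T S : 'M[R]_n) :
  (forall i j, T *m simplex_edge i j = S *m simplex_edge i j) -> T = S.
Proof.
move=> h; apply/eqP; rewrite -subr_eq0; apply/eqP; set N := T - S.
have Nh i j : N *m E *m unit_diff i j = 0.
  by rewrite -mulmxA mulmxBl h subrr.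
have cN k i j : (N *m E) k i = (N *m E) k j.
  have := congr1 (fun z : 'cV_n => z k 0) (Nh i j).
  by rewrite /unit_diff mulmxBr -!colE !mxE => /subr0_eq.
rewrite -[N]mulmx1 -EEt mulmxA.
suff -> : N *m E = 0 by rewrite mul0mx.
apply/matrixP=> k i; rewrite [RHS]mxE.
have := congr1 (fun z : 'cV_n => z k 0) (congr1 (mulmx N) (simplex_const EEt EtE 1)).
rewrite mulmx0 mulmxA mxE [RHS]mxE (eq_bigr (fun=> (N *m E) k i)).
  by rewrite sumr_const card_ord => /eqP; rewrite mulrn_eq0 /= => /eqP.
by move=> j _; rewrite (cN k j i) [const_mx _ _ _]mxE mulr1.
Qed.

(** In the triangle [f_ij + f_jl = f_il] the three edges are eigenvectors and two
    of them are independent, so the eigenvalues agree. *)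
Lemma edge_eigen_const (K : 'M[R]_n) (s : 'I_n.+1 -> 'I_n.+1 -> R) :
  (forall i j, s i j = s j i) ->
  (forall i j, i != j -> K *m simplex_edge i j = s i j *: simplex_edge i j) ->
  forall i j k l, i != j -> k != l -> s i j = s k l.
Proof.
move=> sC eig.
have sh i j l : i != j -> i != l -> s i j = s i l.
  move=> ij il; have [->//|jl] := eqVneq j l.
  have dif : simplex_edge i j + simplex_edge j l = simplex_edge i l.
    by rewrite /simplex_edge -mulmxDr /unit_diff addrA subrK.
  have := congr1 (fun z => E^T *m (K *m z)) dif.
  rewrite !mulmxDr !eig // -!scalemxAr.
  rewrite ![E^T *m simplex_edge _ _](simplex_unit_diff EtE).
  move=> /(congr1 (fun z : 'cV_n.+1 => z i 0)); rewrite mxE !(mxE, unit_diffE) /=.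
  by rewrite !eqxx (negPf ij) (negPf il) !andbT !subr0 !mulr1 mulr0 addr0.
move=> i j k l ij kl; have [il|il] := eqVneq i l.
  by rewrite [s k l]sC -il; apply: sh => //; rewrite il eq_sym.
by rewrite (sh i j l) // [LHS]sC [RHS]sC; apply: sh; rewrite eq_sym // eq_sym.
Qed.

Context (rho : 'I_n.+1 -> 'I_n.+1 -> R) (T : 'M[R]_n).

(** The hypotheses are what equality gives in [sum_enorm_ge_det] for the edges of
    the regular simplex; [s i j] below is the ratio by which [T] scales the edge
    [i j]. *)
Lemma rigidity (Q : 'M[R]_n) (r : R) : (0 < n)%N -> r != 0 -> Q^T *m Q = 1%:M ->
  edge_form rho *m T^T *m Q = r%:M ->
  (forall i j : 'I_n.+1, (i < j)%N -> rho i j != 0 ->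
    T *m simplex_edge i j
    = (enorm (T *m simplex_edge i j) / enorm (simplex_edge i j)) *: (Q *m simplex_edge i j)) ->
  (exists2 s, 0 < s & T^T *m T = (s ^+ 2)%:M) /\
  (forall i j k l : 'I_n.+1, (i < j)%N -> (k < l)%N -> rho i j = rho k l).
Proof.
move=> n0 r0 oQ fr par.
pose s i j := enorm (T *m simplex_edge i j) / enorm (simplex_edge i j).
have edgeC i j : simplex_edge i j = - simplex_edge j i.
  by rewrite /simplex_edge unit_diffC mulmxN.
have sC i j : s i j = s j i by rewrite /s edgeC mulmxN !enormN.
(* The edges of nonzero weight are scaled by [Q^T *m T], which thus only changes the
   weights. *)
have fs : edge_form (fun i j => rho i j * s i j) = r%:M.
  rewrite -fr /edge_form !mulmx_suml; apply: eq_bigr => -[i j] /= ij.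
  have [->|rhoij] := eqVneq (rho i j) 0; first by rewrite mul0r !scale0r !mul0mx.
  have e : (simplex_edge i j)^T *m T^T *m Q = s i j *: (simplex_edge i j)^T.
    rewrite -trmx_mul (par _ _ ij rhoij) linearZ /= -scalemxAl trmx_mul -mulmxA.
    by rewrite oQ mulmx1.
  rewrite -!scalemxAl -scalerA -!mulmxA (mulmxA (simplex_edge i j)^T) e.
  by rewrite -!scalemxAr.
have rs (i j : 'I_n.+1) : (i < j)%N -> rho i j * s i j = r / n.+1%:R :=
  edge_form_scalar_weights fs (i := i) (j := j).
have rs0 (i j : 'I_n.+1) : (i < j)%N -> rho i j * s i j != 0.
  by move=> ij; rewrite rs // mulf_neq0 // invr_eq0.
(* All weights being nonzero, every edge is now known to be scaled by [Q^T *m T]. *)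
have Te i j : i != j -> T *m simplex_edge i j = s i j *: (Q *m simplex_edge i j).
  have up (k l : 'I_n.+1) : (k < l)%N -> T *m simplex_edge k l = s k l *: (Q *m simplex_edge k l).
    by move=> kl; apply: par => //; apply: contra_neq (rs0 _ _ kl) => ->; rewrite mul0r.
  rewrite neq_ltn => /orP[] ij; first exact: up.
  by rewrite edgeC !mulmxN up // sC scalerN.
have sE : forall i j k l, i != j -> k != l -> s i j = s k l.
  apply: (@edge_eigen_const (Q^T *m T)) => // i j ij.
  by rewrite -mulmxA Te // -scalemxAr mulmxA oQ mul1mx.
pose s0 := s ord0 ord_max.
have om : ((ord0 : 'I_n.+1) < (ord_max : 'I_n.+1))%N by [].
have s0_gt0 : 0 < s0.
  rewrite lt_neqAle /s0 /s divr_ge0 ?enorm_ge0 // andbT eq_sym.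
  by have := rs0 _ _ om; rewrite mulf_eq0 negb_or => /andP[].
have omn : ord0 != ord_max :> 'I_n.+1 by rewrite neq_ltn om.
split; last first.
  move=> i j k l ij kl; apply: (mulIf (lt0r_neq0 s0_gt0)).
  rewrite /s0 -{1}(sE i j _ _ _ omn) ?neq_ltn ?ij // -(sE k l _ _ _ omn) ?neq_ltn ?kl //.
  by rewrite !rs.
exists s0 => //; have -> : T = s0 *: Q.
  apply: mx_eq_on_edges => i j; have [->|ij] := eqVneq i j.
    by rewrite /simplex_edge /unit_diff subrr !mulmx0.
  by rewrite Te // -scalemxAl (sE i j _ _ ij omn).
by rewrite [(_ *: Q)^T]linearZ /= -scalemxAl -scalemxAr oQ scalerA scalemx1 expr2.
Qed.

(** Here [edge_form rho] is scalar and [T] multiplies all lengths by [s], so both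
    sides equal [n * (c * n.+1 * s)]. *)
Lemma similarity_equality (s c : R) : (0 < n)%N -> 0 <= s -> T^T *m T = (s ^+ 2)%:M ->
  (forall i j : 'I_n.+1, (i < j)%N -> rho i j = c) -> 0 <= c ->
  \sum_(p : 'I_n.+1 * 'I_n.+1 | (p.1 < p.2)%N)
    rho p.1 p.2 * (enorm (simplex_edge p.1 p.2) * enorm (T *m simplex_edge p.1 p.2))
  = n%:R * `|\det (edge_form rho *m T^T)| `^ n%:R^-1.
Proof.
move=> n0 s0 TT rc c0.
have -> : edge_form rho = (c * n.+1%:R)%:M.
  rewrite -scale_scalar_mx -edge_form_const /edge_form scaler_sumr; apply: eq_bigr => p /rc ->.
  by rewrite scale1r.
have dT : `|\det T| = s ^+ n.
  apply: (@pexpIrn _ 2) => //; rewrite ?nnegrE ?exprn_ge0 //.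
  by rewrite -normrX ger0_norm ?sqr_ge0 // expr2 -{1}det_tr -det_mulmx TT det_scalar exprAC.
rewrite mul_scalar_mx detZ det_tr normrM dT ger0_norm ?exprn_ge0 ?mulr_ge0 ?ler0n // -exprMn.
rewrite rootnK ?mulr_ge0 ?ler0n //.
have nT x : enorm (T *m x) = s * enorm x.
  by rewrite /enorm dotp_mulmx mulmxA TT mul_scalar_mx dotpC dotpZl
             sqrtrM ?sqr_ge0 // sqrtr_sqr ger0_norm.
have /(congr1 mxtrace) := edge_form_const; rewrite mxtrace_scalar raddf_sum /= => tr.
rewrite (eq_bigr (fun p => c * s * \tr (1 *: (simplex_edge p.1 p.2 *m (simplex_edge p.1 p.2)^T)))).
  by rewrite -mulr_sumr tr mulrnAr -mulr_natl; ring.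
move=> p ij; rewrite rc // nT scale1r mxtrace_mulC trace_mx11 -dotpE -sqr_enorm; ring.
Qed.

End Rigidity.

Section RegularFrame.
Context {R : realType} {n : nat} (E : 'M[R]_(n, n.+1)).
Context (EEt : E *m E^T = 1%:M)
  (EtE : E^T *m E = 1%:M - n.+1%:R^-1 *: const_mx 1).

Let n1 : n.+1%:R != 0 :> R. Proof. by rewrite pnatr_eq0. Qed.

(** With [M = E *m frame_mx u], the map [edge_map E u] is [frame_det u *: M^-1],
    and the Gram matrix of the frame is [E^T *m (M *m M^T) *m E].  It is
    proportional to [E^T *m E] exactly when [M] is a similarity. *)
Lemma regular_frameP u : balanced_frame u ->
  regular_frame u <-> exists2 s : R, 0 < s & (edge_map E u)^T *m edge_map E u = (s ^+ 2)%:M.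
Proof.
move=> bu; set T := edge_map E u; set M := E *m frame_mx u.
have MT : M *m T = (frame_det u)%:M := frame_edge_map EtE bu.
have EF : E^T *m M = frame_mx u := simplex_frame EtE (proj1 bu).
split=> [[a a0 reg]|[s s0 TT]].
  have an0 : 0 < a * n.+1%:R by rewrite mulr_gt0 // ltr0n.
  have FF : frame_mx u *m (frame_mx u)^T = (a * n.+1%:R) *: (1%:M - n.+1%:R^-1 *: const_mx 1).
    apply/matrixP=> i j; rewrite -frame_mx_gram reg !mxE mulr1.
    by move: (n.+1%:R) n1 (_ *+ (i == j)) => N N0 k; field.
  have MM : M *m M^T = (a * n.+1%:R)%:M.
    rewrite /M trmx_mul -mulmxA [frame_mx u *m _]mulmxA FF -scalemxAl -scalemxAr.
    by rewrite -EtE -!mulmxA EEt mulmx1 EEt scalemx1.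
  have TE : T = (frame_det u / (a * n.+1%:R)) *: M^T.
    have MtM : M^T *m M = (a * n.+1%:R)%:M.
      apply: (scalerI (a := (a * n.+1%:R)^-1)); first by rewrite invr_eq0 gt_eqF.
      rewrite scale_scalar_mx mulVf ?gt_eqF // scalemxAl; apply: mulmx1C.
      by rewrite -scalemxAr MM scale_scalar_mx mulVf ?gt_eqF.
    apply: (scalerI (a := a * n.+1%:R)); first by rewrite gt_eqF.
    by rewrite [RHS]scalerA [_ * (_ / _)]mulrC divfK ?gt_eqF //
               -mul_scalar_mx -MtM -mulmxA MT mul_mx_scalar.
  (* [T] is [frame_det u / (a * n.+1)] times [M^T], and [M] scales by
     [sqrt (a * n.+1)]. *)
  exists (Num.sqrt (frame_det u ^+ 2 / (a * n.+1%:R))).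
    by rewrite sqrtr_gt0 divr_gt0 // exprn_gt0 // frame_det_gt0.
  rewrite sqr_sqrtr ?divr_ge0 ?sqr_ge0 ?(ltW an0) //.
  rewrite {1}TE [(_ *: M^T)^T]linearZ /= trmxK -scalemxAl MT scale_scalar_mx; congr _%:M.
  by rewrite expr2 mulrAC.
have s20 : s ^+ 2 != 0 by rewrite expf_neq0 // gt_eqF.
have TTt : T *m T^T = (s ^+ 2)%:M.
  apply: (scalerI (a := (s ^+ 2)^-1)); rewrite ?invr_eq0 //.
  rewrite scale_scalar_mx mulVf // scalemxAr; apply: mulmx1C.
  by rewrite -scalemxAl TT scale_scalar_mx mulVf.
have MM : M *m M^T = (frame_det u ^+ 2 / s ^+ 2)%:M.
  apply: (scalerI (a := s ^+ 2)) => //.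
  rewrite [LHS]scalemxAl -mul_mx_scalar -TTt mulmxA MT mul_scalar_mx -scalemxAl.
  rewrite -trmx_mul MT tr_scalar_mx !scale_scalar_mx; congr _%:M.
  by rewrite [RHS]mulrC divfK // expr2.
exists (frame_det u ^+ 2 / s ^+ 2 / n.+1%:R).
  by rewrite !divr_gt0 ?exprn_gt0 ?ltr0n // frame_det_gt0.
move=> i j; rewrite frame_mx_gram -EF trmx_mul trmxK mulmxA -[_ *m M *m M^T]mulmxA MM.
rewrite mul_mx_scalar -scalemxAl EtE !mxE mulr1.
by move: (n.+1%:R) n1 (_ *+ (i == j)) => N N0 k; field; rewrite N0 gt_eqF.
Qed.

End RegularFrame.

Theorem corollary2p3 (R : realType) (n : nat) (u : 'I_n.+1 -> 'cV[R]_n)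
    (w : 'I_n.+1 -> 'I_n.+1 -> 'cV[R]_n) (rho : 'I_n.+1 -> 'I_n.+1 -> R) :
  (2 <= n)%N ->
  balanced_frame u ->
  reciprocal_edges u w ->
  (forall i j : 'I_n.+1, (i < j)%N -> 0 <= rho i j) ->
  let A := weighted_mx rho w in
  let bound := frame_cst R n * (\det A / frame_det u ^+ (n - 1)) `^ n%:R^-1 in
  posdefmx A ->
  bound <= weighted_length rho w /\
  (weighted_length rho w = bound <->
   regular_frame u /\
   (forall i j k l : 'I_n.+1, (i < j)%N -> (k < l)%N -> rho i j = rho k l)).
Proof.
move=> n2 bu rw rho0 A bound pA.
have n0 : (0 < n)%N by apply: leq_trans n2.
have [E [EEt EtE]] := @regular_simplex R n.
pose T := edge_map E u.
have d0 := frame_det_gt0 bu.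
have wE i j : i != j -> w i j = T *m simplex_edge E i j by exact: reciprocal_edgesE.
have AE : A = T *m (edge_form E rho *m T^T).
  rewrite /A /weighted_mx pair_big_dep /edge_form mulmx_suml mulmx_sumr /=.
  apply: eq_bigr => p ij; rewrite wE; last by rewrite neq_ltn ij.
  by rewrite -scalemxAl -scalemxAr trmx_mul !mulmxA.
(* As the edges of the simplex have norm [sqrt 2], both sides of the inequality are
   those of [sum_enorm_ge_det] divided by [sqrt 2]. *)
pose X := edge_form E rho *m T^T.
pose len := \sum_(p : 'I_n.+1 * 'I_n.+1 | (p.1 < p.2)%N)
  rho p.1 p.2 * (enorm (simplex_edge E p.1 p.2) * enorm (T *m simplex_edge E p.1 p.2)).
have s2 : Num.sqrt 2 != 0 :> R by rewrite gt_eqF // sqrtr_gt0.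
have lenE : weighted_length rho w = (Num.sqrt 2)^-1 * len.
  rewrite /weighted_length pair_big_dep /len mulr_sumr; apply: eq_bigr => p /= ij.
  have nij : p.1 != p.2 by rewrite neq_ltn ij.
  by rewrite wE // (enorm_simplex_edge EtE nij) mulrCA mulKf.
have detA := posdefmx_det_gt0 pA; rewrite -/A in detA.
have detX : `|\det X| = Num.sqrt n.+1%:R * (\det A / frame_det u ^+ (n - 1)).
  have dTX : \det A = `|\det T| * `|\det X|.
    by rewrite -normrM -det_mulmx -AE ger0_norm ?ltW.
  rewrite -(det_edge_map EtE bu n0) -/T dTX.
  have sn : Num.sqrt n.+1%:R != 0 :> R by rewrite gt_eqF // sqrtr_gt0 ltr0n.
  have dT : `|\det T| != 0.
    by rewrite normr_eq0; apply/eqP=> e; move: detA; rewrite AE det_mulmx e mul0r ltxx.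
  by field; rewrite sn dT.
have boundE : bound = (Num.sqrt 2)^-1 * (n%:R * `|\det X| `^ n%:R^-1).
  rewrite /bound /frame_cst detX [in RHS]powRM ?sqrtr_ge0 //; last first.
    by rewrite divr_ge0 ?exprn_ge0 ?ltW.
  rewrite -(powR12_sqrt (ler0n R n.+1)) -powRrM natrM invfM.
  by rewrite !mulrA [n%:R * _]mulrC.
have [ineq eqc] := @sum_enorm_ge_det R n _ (fun p : 'I_n.+1 * 'I_n.+1 => (p.1 < p.2)%N)
   (fun p => rho p.1 p.2) (fun p => simplex_edge E p.1 p.2) T n0
   (fun p ij => rho0 _ _ ij).
rewrite -/(edge_form E rho) -/X -/len in ineq eqc.
rewrite lenE boundE; split; first by rewrite ler_pM2l // invr_gt0 sqrtr_gt0.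
have is2 : (Num.sqrt 2)^-1 != 0 :> R by rewrite invr_eq0.
split=> [/(mulfI is2)/eqc[Q [r [oQ XQ par]]]|].
  have r0 : r != 0.
    apply/eqP=> r0; have := congr1 determinant XQ; rewrite r0 det_scalar expr0n gtn_eqF //=.
    rewrite det_mulmx => /eqP; rewrite mulf_eq0 => /orP[] /eqP e.
      by move: detA; rewrite AE det_mulmx e mulr0 ltxx.
    by have /eqP := congr1 determinant oQ; rewrite det_mulmx e mulr0 det1 eq_sym oner_eq0.
  have [|conf rhoE] := rigidity EEt EtE n0 r0 oQ XQ.
    move=> i j ij; apply: (par (i, j)) => //=.
    apply: contra_neq s2 => e0; rewrite -(@enorm_simplex_edge R n E EtE i j) ?neq_ltn ?ij //.
    by rewrite -/(simplex_edge E i j) e0 /enorm -(scale0r 0) dotpZl mul0r sqrtr0.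
  by split=> //; apply/(regular_frameP EEt EtE bu).
move=> [/(regular_frameP EEt EtE bu) [s s0 TT] rhoE].
have om : ((ord0 : 'I_n.+1) < (ord_max : 'I_n.+1))%N by [].
congr (_ * _); apply: (similarity_equality EEt EtE n0 (ltW s0) TT (c := rho ord0 ord_max)).
  by move=> i j ij; apply: rhoE.
exact: rho0.
Qed.
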